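(* Let $X$ be a Tychonoff regular locally Menger $p$-space which has a homogeneous remainder (i.e. $bX\setminus X$ is homogeneous for some compactification $bX$ of $X$). Then $X=L\cup Z$, where $L$ is a closed subspace of $X$ that is a Lindelöf $\Sigma$-space and $Z$ is an open locally compact subspace of $X$.
   Context: A space $X$ is Menger if for each sequence $(\mathcal{U}_n)$ of open covers of $X$ there is a sequence $(\mathcal{V}_n)$ with each $\mathcal{V}_n$ a finite subset of $\mathcal{U}_n$ and $\bigcup_{n}\bigcup\mathcal{V}_n=X$. A space $X$ is locally Menger if for each $x\in X$ there exist an open set $U$ and a Menger subspace $Y$ of $X$ with $x\in U\subseteq Y$. A Tychonoff space $X$ is a $p$-space if in some (equivalently, any) compactification $bX$ there is a countable family $\{\mathcal{U}_n:n\in\mathbb{N}\}$, each $\mathcal{U}_n$ a collection of open subsets of $bX$, such that for each $x\in X$, $x\in\bigcap_{n}\bigcup\{U\in\mathcal{U}_n:x\in U\}\subseteq X$. A Lindelöf $\Sigma$-space is a continuous image of a Lindelöf $p$-space. A space $Y$ is homogeneous if for any $x,y\in Y$ there is a homeomorphism $h:Y\to Y$ with $h(x)=y$. *)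

(* Defs.v *)
From HB Require Import structures.
From mathcomp Require Import all_boot all_order all_algebra.
From mathcomp Require Import all_classical all_reals all_analysis.
Set Implicit Arguments. Unset Strict Implicit. Unset Printing Implicit Defensive.
Import Order.TTheory GRing.Theory Num.Theory.
Local Open Scope classical_set_scope.

(* Tychonoff space: T1 (here Hausdorff, equivalent for completely regular) and
   completely regular. *)
Definition tychonoff_space (T : topologicalType) : Prop :=
  hausdorff_space T /\ completely_regular_space T.

Definition compactification (X bX : topologicalType) (e : X -> bX) : Prop :=
  [/\ hausdorff_space bX, compact [set: bX], continuous e /\ injective e,
      (forall U : set X, open U ->
         exists V : set bX, open V /\ e @` U = V `&` range e)
    & closure (range e) = [set: bX]].

Definition homogeneous_subspace (T : topologicalType) (A : set T) : Prop :=
  forall x y, A x -> A y ->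
    exists h g : T -> T,
      [/\ set_fun A A h /\ set_fun A A g,
          {in A, cancel h g} /\ {in A, cancel g h},
          {within A, continuous h}, {within A, continuous g}
        & h x = y].

Definition star (T : Type) (x : T) (U : set (set T)) : set T :=
  \bigcup_(V in [set V | U V /\ V x]) V.

Definition p_space (X : topologicalType) : Prop :=
  tychonoff_space X /\
  exists (bX : topologicalType) (e : X -> bX),
    compactification e /\
    exists U : nat -> set (set bX),
      (forall n V, U n V -> open V) /\
      forall x : X,
        (\bigcap_n star (e x) (U n)) (e x) /\
        \bigcap_n star (e x) (U n) `<=` range e.

Definition lindelof (T : topologicalType) : Prop :=
  forall U : set (set T), (forall V, U V -> open V) ->
    [set: T] `<=` \bigcup_(V in U) V ->
    exists C : set (set T), [/\ C `<=` U, countable C &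
      [set: T] `<=` \bigcup_(V in C) V].

Definition lindelof_sigma_subspace (X : topologicalType) (L : set X) : Prop :=
  exists (P : topologicalType) (f : P -> X),
    [/\ p_space P, lindelof P, continuous f & range f = L].

(* Menger subspace (open covers of Y taken by open subsets of X, whose traces
   are exactly the open covers of the subspace Y). *)
Definition menger_subspace (X : topologicalType) (Y : set X) : Prop :=
  forall U : nat -> set (set X),
    (forall n, (forall V, U n V -> open V) /\ Y `<=` \bigcup_(V in U n) V) ->
    exists F : nat -> set (set X),
      (forall n, finite_set (F n) /\ F n `<=` U n) /\
      Y `<=` \bigcup_n \bigcup_(V in F n) V.

Definition locally_menger (X : topologicalType) : Prop :=
  forall x : X, exists (U Y : set X),
    [/\ open U, U x, U `<=` Y & menger_subspace Y].

(* Z (open in X) is locally compact as a subspace: every point of Z has a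
   compact neighbourhood contained in Z. *)
Definition locally_compact_subspace (X : topologicalType) (Z : set X) : Prop :=
  forall z, Z z -> exists K : set X, [/\ compact K, K `<=` Z & nbhs z K].

Definition has_homogeneous_remainder (X : topologicalType) : Prop :=
  exists (bX : topologicalType) (e : X -> bX),
    compactification e /\ homogeneous_subspace (~` range e).

(* Main.v *)
Require Import Defs.
From HB Require Import structures.
From mathcomp Require Import finmap all_boot all_classical all_reals all_analysis.
Local Open Scope classical_set_scope.
Set Implicit Arguments. Unset Strict Implicit. Unset Printing Implicit Defensive.

(** Identify [X] with its image in the compactification [B] whose remainder
    [R := B \ X] is homogeneous, and take [L := X ∩ cl R], [Z := X \ L].
    A point of [X] has a neighbourhood whose closure [G] in [B] has Lindelöf
    trace on [X]; since [X] is a p-space, countably many open sets [O] of [B]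
    separate the points [a] of [G ∩ X] from the points [r] of [R], in the sense
    that [a ∈ O] and [r ∉ cl O].  Passing to the sets [B \ cl O] gives the same
    kind of separation of [R ∩ G] from [X ∩ G].  If [L] is nonempty, [G] can be
    taken to be a neighbourhood of a point of [R], so by homogeneity [R] and [X]
    are separated near every point of [R], hence near every point of the compact
    set [cl R].  Therefore countably many closed sets [s n] of [B] separate [L]
    from [B \ L], and [L] is the projection of the set of all [(b, c)] in
    [B × 2^ℕ] with [b ∈ s n] whenever [c n] holds and with [∩_(c n) s n ⊂ L].
    That set is the trace on a compact space of the preimage of a subset of
    [2^ℕ], and is therefore a Lindelöf p-space. *)

(** * Compact Hausdorff spaces *)

Lemma hausdorff_disjoint_nbhs (T : topologicalType) (x y : T) :
  hausdorff_space T -> x <> y ->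
  exists U V, [/\ nbhs x U, nbhs y V & U `&` V = set0].
Proof.
rewrite open_hausdorff => hT /eqP /hT [[U V]/= [xU yV] [oU oV /eqP UV]].
exists U, V; split => //; apply: open_nbhs_nbhs; split => //; exact/set_mem.
Qed.

Lemma compact_hausdorff_regular (T : topologicalType) :
  hausdorff_space T -> compact [set: T] -> regular_space T.
Proof. by move=> hT cT x; apply: compact_regular hT cT _; exact: filterT. Qed.

Lemma compact_cover_compact (T : topologicalType) (K : set T) :
  compact K -> cover_compact K.
Proof.
move=> cK I D g og covg.
have [K0|/set0P[x Kx]] := eqVneq K set0.
  by exists fset0 => // x; rewrite K0.
(* [compact_cover] is about pointed spaces; a point of [K] serves as base point and the topology is
   unchanged. *)
pose pT : ptopologicalType := HB.pack T (isPointed.Build T x).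
have : @compact pT K by [].
by rewrite compact_cover => /(_ I D g og covg).
Qed.

(** * Subspaces of compact Hausdorff spaces *)

Section subtype.
Variables (T : topologicalType).
Implicit Types S : set T.

Lemma nbhs_set_val S (x : S) (U : set S) :
  nbhs x U <-> exists2 V, nbhs (set_val x) V & set_val @^-1` V `<=` U.
Proof.
split=> [[_ [[V oV <-] Vx VU]]|[V Vx VU]].
  by exists V => //; exact: open_nbhs_nbhs.
by apply: filterS VU _; exact: initial_continuous.
Qed.

Lemma hausdorff_set_type S : hausdorff_space T -> hausdorff_space S.
Proof.
move=> hT x y xy; apply: val_inj; apply: hT => A B xA yB.
have [||z [Az Bz]] := xy (set_val @^-1` A) (set_val @^-1` B).
- by apply/nbhs_set_val; exists A.
- by apply/nbhs_set_val; exists B.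
- by exists (set_val z).
Qed.

Lemma compact_set_type S : compact S -> compact [set: S].
Proof.
move=> cS F FF _; have FS : (set_val @ F) S.
  by apply: (@filterS _ F _ setT) => [[x Sx] _|]; [exact: set_mem|exact: filterT].
have [x [Sx xF]] := cS _ _ FS.
exists (exist _ x (mem_set Sx)); split=> // A B FA /nbhs_set_val[V xV VB].
have [|_ [[z Az <-] Vz]] := xF (set_val @` A) V _ xV.
  by apply: (@filterS _ F _ A) FA => z Az; exists z.
by exists z; split => //; exact: VB.
Qed.

(** [T] is normal, so a uniformity coarser than its topology separates a point from a closed set;
    the pullback along [set_val] does so in [S]. *)
Lemma completely_regular_set_type S :
  hausdorff_space T -> compact [set: T] -> completely_regular_space S.
Proof.
move=> hT cT a B clB nBa.
have /nbhs_set_val[V] : nbhs a (~` B).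
  by apply: open_nbhs_nbhs; split => //; rewrite openC.
rewrite nbhsE => -[W [oW Wa] WV] VB.
have [||||uT [E] /= [entE sepE nbE]] :=
  @normal_uniform_separator T _ [set set_val a] (~` W).
- exact: compact_normal.
- exact/accessible_closed_set1/hausdorff_accessible.
- exact: open_closedC.
- by apply/disjoints_subset => _ ->; rewrite setCK.
pose UT : uniformType := Uniform.Pack uT.
pose g : S -> UT := set_val.
exists (Uniform.class (initial_topology g)), [set xy | E (g xy.1, g xy.2)] => /=.
split.
- by exists E.
- rewrite -subset0 => -[x y] [[/= -> By] Exy].
  suff : set0 (g a, g y) by [].
  rewrite -sepE; split => //; split => //= Wy.
  by apply: VB By; exact: WV.
- move=> x A [_ [[C oC <-] Cx CA]]; apply/nbhs_set_val.
  by exists C => //; apply: nbE; exact: (@open_nbhs_nbhs UT).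
Qed.

End subtype.

Definition closure_incl (T : topologicalType) (S : set T) (x : S) : closure S :=
  exist _ (set_val x) (mem_set (@subset_closure _ S _ (set_mem (valP x)))).

Lemma compactification_closure (T : topologicalType) (S : set T) :
  hausdorff_space T -> compact [set: T] ->
  compactification (@closure_incl T S).
Proof.
move=> hT cT; split.
- exact: hausdorff_set_type.
- apply: compact_set_type.
  by rewrite -[closure S]setTI; apply: compact_closedI cT _; exact: closed_closure.
- split; last by move=> x y [] /val_inj.
  move=> x U /nbhs_set_val[V xV VU]; apply/nbhs_set_val.
  by exists V => // y Vy; exact: VU.
- move=> _ [V oV <-]; exists (set_val @^-1` V).
  split; first by exists V.
  apply/seteqP; split=> [y [x Vx <-]|y [Vy [x _ xy]]].
    by split => //; exists x.
  by rewrite -xy; exists x => //; rewrite -xy in Vy.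
- apply/seteqP; split=> // x _ B /nbhs_set_val[V xV VB].
  have [y [Sy Vy]] := set_mem (valP x) _ xV.
  exists (closure_incl (exist _ y (mem_set Sy))); split.
    by exists (exist _ y (mem_set Sy)).
  exact: VB.
Qed.

Lemma tychonoff_set_type (T : topologicalType) (S : set T) :
  hausdorff_space T -> compact [set: T] -> tychonoff_space S.
Proof.
by move=> hT cT; split; [exact: hausdorff_set_type|exact: completely_regular_set_type].
Qed.

(** * Preimages of subsets of the Cantor space *)

Section cantor_preimage.
Variables (T : topologicalType) (K : set T) (f : T -> cantor_space).
Variable (M : set cantor_space).
Hypotheses (cT : compact [set: T]) (clK : closed K) (cf : continuous f).

Let coord_continuous n : continuous (fun t => f t n).
Proof.
move=> t; apply: (@continuous_comp _ _ _ f (fun c : cantor_space => c n)).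
  exact: cf.
exact: (@proj_continuous nat (fun=> bool) n).
Qed.

Lemma open_cantor_coord n b : open [set t | f t n = b].
Proof.
have -> : [set t | f t n = b] = (fun t => f t n) @^-1` [set b] by [].
by apply: open_comp => [x _|]; [exact: coord_continuous|exact: discrete_open].
Qed.

(** The [n]-th family consists of preimages of cylinders of length [n], so the stars of [x]
    intersect in its fibre within [closure S]. That fibre lies in [K], which is closed, and in the
    preimage of [M], hence in [S]. *)
Lemma p_space_cantor_preimage : hausdorff_space T -> p_space (K `&` f @^-1` M).
Proof.
move=> hT; set S := K `&` _; split; first exact: tychonoff_set_type.
exists (closure S), (@closure_incl T S).
split; first exact: compactification_closure.
exists (fun n => [set [set y : closure S | forall m, (m < n)%N -> f (set_val y) m = c m]
  | c in [set: cantor_space]]).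
split=> [n _ [c _ <-]|x].
  rewrite openE => y yc; apply/nbhs_set_val.
  exists (\bigcap_(m < n) [set t | f t m = c m]); last by move=> z zc m mn; exact: zc.
  elim: n yc => [|n IH] yc; first by apply: filterS filterT => t _ m.
  have := IH (fun m mn => yc m (ltnW mn)).
  have : nbhs (set_val y) [set t | f t n = c n].
    by apply: open_nbhs_nbhs; split; [exact: open_cantor_coord|exact: yc].
  apply: filterS2 => t tn tlt m /=; rewrite ltnS leq_eqVlt => /predU1P[->//|].
  exact: tlt.
split=> [n _|y yx].
  by exists [set y : closure S | forall m, (m < n)%N ->
    f (set_val y) m = f (set_val (closure_incl x)) m] => //; split => //;
    exists (f (set_val (closure_incl x))).
have Sy : S (set_val y).
  split.
    have -> : K = closure K by exact/closure_id.
    by apply: closureS (set_mem (valP y)) => ? [].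
  suff -> : (f @^-1` M) (set_val y) = M (f (set_val x)) by case: (set_mem (valP x)).
  rewrite /preimage /=; congr (M _); apply/funext => m.
  (* Length [m.+1] is the first at which a cylinder fixes coordinate [m]. *)
  have [_ [[c _ <-] xc] yc] := yx m.+1 I.
  by rewrite yc//; symmetry; exact: (xc m).
by exists (exist _ (set_val y) (mem_set Sy)) => //; exact: val_inj.
Qed.

(** The fibre through a point of [S] is compact, so finitely many members of [U] cover it, and even
    the trace of a whole cylinder around it. There are only countably many cylinders [cyl s]. *)
Lemma lindelof_cantor_preimage : lindelof (K `&` f @^-1` M).
Proof.
set S := K `&` _ => U oU covU.
pose cyl (s : seq (nat * bool)) : set T := [set t | forall n b, (n, b) \in s -> f t n = b].
pose good s (F : set (set S)) := [/\ finite_set F, F `<=` U &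
  set_val @^-1` cyl s `<=` \bigcup_(V in F) V].
have goodE (x : S) : exists s F, good s F /\ cyl s (set_val x).
  pose c := f (set_val x).
  pose D : set (nat + set S) := [set i | if i is inr V then U V else True].
  (* The sets [inl n] cover [K] off the fibre of [x] and the sets [inr V] cover the fibre; a finite
     subcover yields both the coordinates in [s] and the subfamily of [U]. *)
  pose g (i : nat + set S) : set T :=
    match i with
    | inl n => [set t | f t n = ~~ c n]
    | inr V => \bigcup_(W in [set W | open W /\ set_val @^-1` W `<=` V]) W
    end.
  have cK : compact K by rewrite -[K]setTI; exact: compact_closedI.
  move/compact_cover_compact: cK => /(_ _ D g)[].
  - case=> [n|V] _; first exact: open_cantor_coord.
    by apply: bigcup_open => W [].
  - move=> t Kt; have [ftc|] := pselect (f t = c).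
      have St : S t.
        by split => //; rewrite /preimage /= ftc; case: (set_mem (valP x)).
      have [V UV Vt] := covU (exist _ t (mem_set St)) I.
      have [W oW WV] := oU _ UV.
      exists (inr V) => //; exists W; first by split => //; rewrite WV.
      by move: Vt; rewrite -WV.
    move=> ftc; apply: contrapT => nt; apply: ftc; apply/funext => n.
    apply: contrapT => fn; apply: nt; exists (inl n) => //=.
    by move: fn; case: (f t n); case: (c n).
  - move=> D' sD covD.
    pose coord (i : nat + set S) := if i is inl n then Some n else None.
    exists [seq (n, c n) | n <- pmap coord (enum_fset D')].
    exists (inr @^-1` [set` D']); split; last first.
      by move=> n b /mapP[m _ [-> ->]].
    split.
    + apply: finite_preimage; first by move=> ? ? _ _ [].
      exact: finite_fset.
    + by move=> V /= /sD; rewrite inE.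
    + move=> y ys; have [|[n|V] iD giy] := covD (set_val y).
      * by case: (set_mem (valP y)).
      * have : f (set_val y) n = c n.
          apply: ys; apply: map_f; rewrite mem_pmap.
          by apply/mapP; exists (inl n).
        by rewrite giy; case: (c n).
      * by case: giy => W [_ WV] Wy; exists V => //; exact: WV.
(* One finite subfamily is fixed per cylinder; [set0] is a dummy where none exists. *)
have /choice[F FP] : forall s, exists F, (exists F, good s F) -> good s F.
  move=> s; have [[F gF]|nF] := pselect (exists F, good s F); first by exists F.
  by exists set0.
exists (\bigcup_(s in [set s | exists F, good s F]) F s); split.
- by move=> V [s gs FV]; have [_ + _] := FP s gs; exact.
- apply: bigcup_countable => [|s gs]; first exact: countableP.
  by have [? _ _] := FP s gs; exact: finite_set_countable.
- move=> x _; have [s [F0 [gs cx]]] := goodE x.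
  have gs' : exists F, good s F by exists F0.
  have [_ _ /(_ x cx)[V FV Vx]] := FP s gs'.
  by exists V => //; exists s.
Qed.

End cantor_preimage.

(** * Transfer of open sets along a partial map *)

Section inner_image.
Variables (I : Type) (B C : topologicalType) (p : I -> B) (q : I -> C).
Variable (D : set I).

(* When [p] embeds [D] in [B], this is the canonical way to move the open set
   [O] of [C] to [B] along the partial map [q \o p^-1]. *)
Definition inner_image (O : set C) : set B :=
  [set b | exists2 W, nbhs b W & closure (q @` (D `&` p @^-1` W)) `<=` O].

Lemma open_inner_image O : open (inner_image O).
Proof.
rewrite openE => b [W /nbhs_interior bW WO].
by apply: filterS bW => b' b'W; exists W.
Qed.

(** The last hypothesis is continuity of [q \o p^-1] at [p i] along [D]; regularity then fits a
    closure into [O]. *)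
Lemma inner_imageP (O : set C) i : regular_space C -> nbhs (q i) O ->
  (forall N, nbhs (q i) N ->
     exists2 W, nbhs (p i) W & D `&` p @^-1` W `<=` q @^-1` N) ->
  inner_image O (p i).
Proof.
move=> rC qO cq; have [N qN NO] := rC _ _ qO.
have [W pW WN] := cq _ qN; exists W => //.
by apply: subset_trans NO; apply: closureS => _ [j /WN jN <-].
Qed.

(** [z] is a cluster point of the filter generated by the [q]-images of the traces on [D] of
    neighbourhoods of [b]. It lies in the closure of each of them, so a single [z] serves all
    [O]. *)
Lemma inner_image_cluster (K : set C) b : compact K -> q @` D `<=` K ->
  closure (p @` D) b ->
  exists2 z, K z & (forall O, inner_image O b -> O z) /\
    forall W N, nbhs b W -> nbhs z N -> exists i, [/\ D i, W (p i) & N (q i)].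
Proof.
move=> cK qK bD.
pose F := filter_from (nbhs b) (fun W => q @` (D `&` p @^-1` W)).
have FF : ProperFilter F.
  apply: filter_from_proper.
    apply: filter_from_filter; first by exists setT; exact: filterT.
    move=> V W bV bW; exists (V `&` W); first exact: filterI.
    by move=> _ [i [Di [Vi Wi]] <-]; split; exists i.
  by move=> W /bD[_ [[i Di <-] Wi]]; exists (q i); exists i.
have [|z [Kz zF]] := cK F FF.
  exists setT; first exact: filterT.
  by move=> _ [i [Di _] <-]; apply: qK; exists i.
exists z => //; split=> [P [W bW WO]|W N bW zN].
  by apply: WO => N zN; apply: zF => //; exists W.
have [|_ [[i [Di Wi] <-] Ni]] := zF (q @` (D `&` p @^-1` W)) N _ zN.
  by exists W.
by exists i.
Qed.

End inner_image.

(** * Compactifications and the p-space condition *)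

Section embedding.
Variables (X B : topologicalType) (e : X -> B).
Hypothesis cptn : compactification e.

Let hB : hausdorff_space B. Proof. by case: cptn. Qed.
Let cB : compact [set: B]. Proof. by case: cptn. Qed.
Let rB : regular_space B. Proof. exact: compact_hausdorff_regular. Qed.

Lemma compactification_continuous : continuous e.
Proof. by case: cptn => _ _ []. Qed.

Lemma compactification_inj : injective e.
Proof. by case: cptn => _ _ []. Qed.

Lemma compactification_nbhs x (U : set X) : nbhs x U ->
  exists2 V, nbhs (e x) V & e @^-1` V `<=` U.
Proof.
rewrite nbhsE => -[U' [oU' U'x] U'U]; case: cptn => _ _ _ /(_ _ oU')[V [oV UV]] _.
exists V.
  apply: open_nbhs_nbhs; split => //.
  have : (e @` U') (e x) by exists x.
  by rewrite UV => -[].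
move=> y Vy; apply: U'U.
have : (V `&` range e) (e y) by split => //; exists y.
by rewrite -UV => -[z U'z /compactification_inj <-].
Qed.

Lemma compact_preimage_compactification (G : set B) :
  closed G -> G `<=` range e -> compact (e @^-1` G).
Proof.
move=> clG Ge F FF FG.
have cG : compact G by rewrite -[G]setTI; exact: compact_closedI.
have [b [Gb bF]] := cG (e @ F) _ FG.
have [x _ xb] := Ge _ Gb.
exists x; split; first by rewrite /preimage /= xb.
move=> V W FV /compactification_nbhs[W' xW' W'W].
have [||_ [[y Vy <-] W'y]] := bF (e @` V) W'.
- by apply: (@filterS _ F _ V) FV => y Vy; exists y.
- by rewrite -xb.
by exists y; split => //; exact: W'W.
Qed.

End embedding.

(** The p-space condition passes from the given compactification [B'] to any other: the families are
    moved by [inner_image]. A point [b] in all stars of [e x] has a companion [z] in all stars of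
    [e' x], so [z = e' y], and [b = e y] since points of [X] come close to [b] and [z]
    simultaneously. *)
Lemma p_space_feathering (X B : topologicalType) (e : X -> B) :
  compactification e -> p_space X ->
  exists U : nat -> set (set B),
    (forall n V, U n V -> open V) /\
    forall x : X,
      (\bigcap_n star (e x) (U n)) (e x) /\
      \bigcap_n star (e x) (U n) `<=` range e.
Proof.
move=> ce [_ [B' [e' [ce' [U [oU UP]]]]]].
have [hB cB _ _ dB] := ce; have [hB' cB' _ _ _] := ce'.
exists (fun n => [set inner_image e e' setT V | V in U n]); split.
  by move=> n _ [V _ <-]; exact: open_inner_image.
move=> x; have [xU Ux] := UP x; split.
  move=> n _; have [V [UV Vx] _] := xU n I.
  suff Vex : inner_image e e' setT V (e x).
    by exists (inner_image e e' setT V) => //; split => //; exists V.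
  apply: inner_imageP.
  - exact: compact_hausdorff_regular.
  - by apply: open_nbhs_nbhs; split => //; exact: oU UV.
  - move=> N /(compactification_continuous ce') /(compactification_nbhs ce)[W xW WN].
    by exists W => // y [_ /WN].
move=> b bU.
have [||z _ [zO zN]] := @inner_image_cluster _ _ _ e e' setT setT b cB' => //.
  by rewrite dB.
have [y _ yz] : range e' z.
  apply: Ux => n _; have [_ [[V UV <-] Vx] Vb] := bU n I.
  exists V; last exact: zO.
  split => //.
  have [W xW WV] := Vx; apply: WV; apply: subset_closure.
  by exists x => //; split => //; exact: nbhs_singleton xW.
exists y => //; apply: contrapT => /(hausdorff_disjoint_nbhs hB)[W1 [W2 [yW bW W0]]].
have [N yN NW] := compactification_nbhs ce' (compactification_continuous ce yW).
rewrite yz in yN; have [i [_ W2i Ni]] := zN _ _ bW yN.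
suff : (W1 `&` W2) (e i) by rewrite W0.
by split => //; exact: NW.
Qed.

(** * Local Menger property and separation from the remainder *)

(** The Menger property is applied to the constant sequence of covers [U] together with the
    complement of [H], which is dropped afterwards. *)
Lemma menger_closed_lindelof (X : topologicalType) (Y H : set X)
    (U : set (set X)) :
  menger_subspace Y -> closed H -> H `<=` Y ->
  (forall V, U V -> open V) -> H `<=` \bigcup_(V in U) V ->
  exists C, [/\ C `<=` U, countable C & H `<=` \bigcup_(V in C) V].
Proof.
move=> mY clH HY oU HU.
have [|F [FP YF]] := mY (fun=> U `|` [set ~` H]).
  move=> _; split=> [V [/oU//|->]|y Yy]; first exact: closed_openC.
  have [Hy|nHy] := pselect (H y); last by exists (~` H) => //; right.
  by have [V UV Vy] := HU _ Hy; exists V => //; left.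
exists (U `&` \bigcup_n F n); split; first by move=> V [].
  apply: sub_countable (bigcup_countable (countableP setT) _).
    by apply: subset_card_le; exact: subIsetr.
  by move=> n _; apply: finite_set_countable; have [] := FP n.
move=> x Hx; have [n _ [V FV Vx]] := YF _ (HY _ Hx).
exists V => //; split; last by exists n.
by have [_ /(_ _ FV)[//|VH]] := FP n; rewrite VH in Vx.
Qed.

(** For each [n], countably many open sets with closure inside a member of [U n] cover the trace of
    [G]. If none of them separates [a] from [b], then [b] is in every star of [a], hence in the
    range of [e]. *)
Lemma locally_menger_separation (X B : topologicalType) (e : X -> B) x :
  compactification e -> p_space X -> locally_menger X ->
  exists G (V : set (set B)), [/\ nbhs (e x) G, closed G, countable V,
    (forall O, V O -> open O) &
    forall a b, (G `&` range e) a -> ~ range e b ->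
      exists O, [/\ V O, O a & ~ closure O b]].
Proof.
move=> ce pX lm; have [hB cB _ _ _] := ce.
have rB := compact_hausdorff_regular hB cB.
have [Q [Y [oQ Qx QY mY]]] := lm x.
have [W xW WQ] := compactification_nbhs ce (open_nbhs_nbhs (conj oQ Qx)).
have [G0 xG0 GW] := rB _ _ xW.
have [U [oU UP]] := p_space_feathering ce pX.
pose fine n := [set O : set B | open O /\ exists2 P, U n P & closure O `<=` P].
have clG : closed (e @^-1` closure G0).
  apply: preimage_closed; last exact: closed_closure.
  by move=> y _; exact: (compactification_continuous ce).
have ctb n : exists V : set (set B), [/\ V `<=` fine n, countable V &
    e @^-1` closure G0 `<=` \bigcup_(O in V) (e @^-1` O)].
  have [||||C [CU ctC GC]] := @menger_closed_lindelof X Y (e @^-1` closure G0)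
    [set e @^-1` O | O in fine n] mY => //.
  - by move=> y /GW /WQ /QY.
  - move=> _ [P [oO _] <-]; apply: open_comp => // y _.
    exact: (compactification_continuous ce).
  - move=> y _; have [/(_ n I)[P [UP' Py] _] _] := UP y.
    have [N yN NP] := rB _ _ (open_nbhs_nbhs (conj (oU _ _ UP') Py)).
    exists (e @^-1` N°); last exact: yN.
    exists N° => //; split; first exact: open_interior.
    exists P => //; apply: subset_trans NP; apply: closureS.
    exact: interior_subset.
  have /choice[g gP] : forall P, exists O, C P -> fine n O /\ e @^-1` O = P.
    move=> P; have [/CU[P' fP' P'P]|nC] := pselect (C P); first by exists P'.
    by exists set0.
  exists (g @` C); split.
  - by move=> _ [P /gP[fO _] <-].
  - by apply: sub_countable ctC; exact: card_image_le.
  - move=> y /GC[P CP Py]; exists (g P); first by exists P.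
    by have [_ ->] := gP _ CP.
have [V VP] := choice ctb.
exists (closure G0), (\bigcup_n V n); split.
- by apply: filterS xG0; exact: subset_closure.
- exact: closed_closure.
- by apply: bigcup_countable => // n _; have [] := VP n.
- by move=> O [n _]; have [+ _ _] := VP n => /[apply] -[].
- move=> b0 b [Ga [a _ ab]] nb; subst b0; apply: contrapT => nO; apply: nb.
  have [_] := UP a; apply => n _; have [Vf _ GV] := VP n.
  have [W' VO Oa] := GV _ Ga; have [oO [P UP' OP]] := Vf _ VO.
  exists P; first by split => //; apply: OP; exact: subset_closure.
  apply: OP; apply: contrapT => nOb; apply: nO; exists W'; split => //.
  by exists n.
Qed.

(** * Homogeneity and separation near the remainder *)

Lemma countable_setU (T : Type) (A B : set T) :
  countable A -> countable B -> countable (A `|` B).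
Proof.
move=> ctA ctB.
have -> : A `|` B = \bigcup_(b in [set: bool]) (if b then A else B).
  apply/seteqP; split=> [x [Ax|Bx]|x [[] _ ?]]; [| |by left|by right].
    by exists true.
  by exists false.
by apply: bigcup_countable => [|[] _ //]; exact: countableP.
Qed.

Lemma within_continuous_nbhs (S T : topologicalType) (A : set S) (f : S -> T) x
    (U : set T) :
  {within A, continuous f} -> A x -> nbhs (f x) U ->
  exists2 N, nbhs x N & A `&` N `<=` f @^-1` U.
Proof.
move=> /subspace_continuousP cf Ax fxU; exists [set t | A t -> U (f t)].
  exact: cf fxU.
by move=> t [At]; exact.
Qed.

(* The family separates the points of [closure R `\` R] from those of [R], but
   only inside the neighbourhood [G] of [b]. *)
Definition separated_near (B : topologicalType) (R : set B) (b : B) :=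
  exists (G : set B) (F : set (set B)), [/\ nbhs b G, countable F,
    (forall P, F P -> closed P) &
    forall a r, (G `&` closure R `\` R) a -> (G `&` R) r ->
      exists P, [/\ F P, P a & ~ P r]].

(** The homeomorphism [g] sends [y] to [y0] but acts on [R] only. A point [a] of the closure outside
    [R] is therefore replaced by a limit [z] of [g] at [a], and [V] separates [z] from [g r]. *)
Lemma homogeneous_separated_near (B : topologicalType) (R G0 : set B)
    (V : set (set B)) (y0 y : B) :
  hausdorff_space B -> compact [set: B] -> homogeneous_subspace R ->
  closed G0 -> nbhs y0 G0 -> R y0 -> countable V ->
  (forall a r, (G0 `\` R) a -> R r ->
     exists O, [/\ V O, O a & ~ closure O r]) ->
  R y -> separated_near R y.
Proof.
move=> hB cB homR clG0 y0G0 Ry0 ctV sepV Ry.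
have rB := compact_hausdorff_regular hB cB.
have [h [g [[hR gR] [hK gK] ch cg hy]]] := homR _ _ Ry0 Ry.
have [|N yN NG0] := within_continuous_nbhs (U := G0) cg Ry.
  by rewrite -hy hK ?inE.
pose D := R `&` N°.
pose sh (P : set B) := inner_image id g D (~` closure P).
exists N°, [set ~` sh P | P in V]; split.
- exact: nbhs_interior.
- by apply: sub_countable ctV; exact: card_image_le.
- by move=> _ [P _ <-]; apply: open_closedC; exact: open_inner_image.
move=> a r [[Na Ra] nRa] [Nr Rr].
have cG0 : compact G0 by rewrite -[G0]setTI; exact: compact_closedI.
have [||z G0z [zsh zN]] := @inner_image_cluster _ _ _ id g D G0 a cG0.
- by move=> _ [t [Rt Nt] <-]; apply: NG0; split => //; exact: interior_subset.
- move=> W aW; have aN := open_nbhs_nbhs (conj (open_interior N) Na).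
  have [t [Rt [Nt Wt]]] := Ra _ (filterI aN aW).
  by exists t; split => //; exists t.
(* If [z] were in [R], continuity of [h] at [z] would force [h z = a], putting [a] in [R]. *)
have nRz : ~ R z.
  move=> Rz; have [|W1 [W2 [hzW1 aW2 W0]]] := @hausdorff_disjoint_nbhs _ (h z) a hB.
    by move=> hza; apply: nRa; rewrite -hza; exact: hR.
  have [N' zN' N'W1] := within_continuous_nbhs ch Rz hzW1.
  have [i [[Ri _] W2i N'gi]] := zN _ _ aW2 zN'.
  suff : (W1 `&` W2) i by rewrite W0.
  split => //; rewrite -[i]gK ?inE//; apply: N'W1; split => //; exact: gR.
have [P [VP Pz nPr]] := sepV z (g r) (conj G0z nRz) (gR _ Rr).
exists (~` sh P); split; first by exists P.
  by move=> /zsh; apply; exact: subset_closure.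
apply; apply: inner_imageP => //.
  by apply: open_nbhs_nbhs; split => //; apply: closed_openC; exact: closed_closure.
move=> M grM; have [W rW WM] := within_continuous_nbhs cg Rr grM.
by exists W => // t [[Rt _] Wt]; exact: WM.
Qed.

Lemma separated_near_closure (B : topologicalType) (R : set B) :
  hausdorff_space B -> compact [set: B] ->
  (forall b, closure R b -> separated_near R b) ->
  exists F : set (set B), [/\ countable F, forall P, F P -> closed P &
    forall a r, (closure R `\` R) a -> ~ (closure R `\` R) r ->
      exists P, [/\ F P, P a & ~ P r]].
Proof.
move=> hB cB sepR.
have /choice[G GP] : forall b, exists GF : set B * set (set B), closure R b ->
    [/\ nbhs b GF.1, countable GF.2, (forall P, GF.2 P -> closed P) &
      forall a r, (closure GF.1 `&` closure R `\` R) a -> (closure GF.1 `&` R) r ->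
        exists P, [/\ GF.2 P, P a & ~ P r]].
  move=> b; have [/sepR[G [F [bG ctF clF sepF]]]|] := pselect (closure R b).
    have [G1 bG1 G1G] := compact_hausdorff_regular hB cB bG.
    exists (G1, F) => _; split => // a r [[Ga Ra] nRa] [Gr Rr].
    by apply: sepF; do ?split => //; exact: G1G.
  by exists (set0, set0).
have cR : compact (closure R).
  by rewrite -[closure R]setTI; apply: compact_closedI cB _; exact: closed_closure.
have [||D' sD covD] := @compact_cover_compact _ _ cR _ (closure R) (fun b => (G b).1°).
- by move=> b _; exact: open_interior.
- by move=> b Rb; exists b => //; have [/nbhs_interior/nbhs_singleton] := GP b Rb.
(* [closure R] excludes the [r] outside it, and [closure (G b).1] the [r] of [R] away from [b]; the
   local family of [b] deals with the rest. *)
exists ([set closure R] `|` \bigcup_(b in [set` D']) ([set closure (G b).1] `|` (G b).2)).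
split.
- apply: countable_setU; first exact: countable1.
  apply: bigcup_countable => [|b bD]; first exact: countable_fset.
  apply: countable_setU; first exact: countable1.
  by have [|_ ? _ _] := GP b; first exact/set_mem/sD.
- move=> P [->|[b bD [->|bP]]]; [exact: closed_closure|exact: closed_closure|].
  by have [|_ _ + _] := GP b; [exact/set_mem/sD|exact].
- move=> a r [Ra nRa] nr; have [Rr|nRr] := pselect (closure R r); last first.
    by exists (closure R); split => //; left.
  have {nr Rr} Rr : R r by apply: contrapT => nRr; exact: nr.
  have [b bD aG] := covD _ Ra.
  have Rb : closure R b by exact/set_mem/sD.
  have Ga : closure (G b).1 a by apply: subset_closure; exact: interior_subset.
  have [_ _ _ sepb] := GP b Rb.
  have [Gr|nGr] := pselect (closure (G b).1 r); last first.
    by exists (closure (G b).1); split => //; right; exists b => //; left.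
  have [||P [FP Pa nPr]] := sepb a r; [by []|by []|].
  by exists P; split => //; right; exists b => //; right.
Qed.

(** * Lindelöf Σ-subspaces from countable closed separation *)

Lemma separated_lindelof_sigma (X B : topologicalType) (e : X -> B) (A : set B)
    (F : set (set B)) :
  compactification e -> A `<=` range e -> countable F ->
  (forall P, F P -> closed P) ->
  (forall a r, A a -> ~ A r -> exists P, [/\ F P, P a & ~ P r]) ->
  lindelof_sigma_subspace (e @^-1` A).
Proof.
move=> ce AE ctF clF sepF; have [hB cB _ _ _] := ce.
have [s sF clS] : exists2 s : nat -> set B, F `<=` range s & forall n, closed (s n).
  (* Adding [setT] makes the family nonempty, so that it is enumerated by all of [nat]. *)
  have : countable (F `|` [set setT]).
    by apply: countable_setU => //; exact: countable1.
  move=> /pfcard_geP[F0|[s]].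
    suff : (set0 : set (set B)) setT by [].
    by rewrite -F0; right.
  exists s => [P FP|n].
    by have [|n _ <-] := 'surj_s (_ : (F `|` [set setT]) P); [left|exists n].
  by have [/clF//|->] := 'funS_s I : (F `|` [set setT]) (s n); exact: closedT.
pose K : set (B * cantor_space) := [set t : B * cantor_space | forall n, t.2 n -> s n t.1].
pose M : set cantor_space :=
  [set c : cantor_space | forall b, (forall n, c n -> s n b) -> A b].
have hT : hausdorff_space (B * cantor_space)%type.
  move=> [b c] [b' c'] bc; congr pair.
    apply: hB => U V bU b'V.
    have [||[x y] [/= Ux Vx]] := bc (fst @^-1` U) (fst @^-1` V); last by exists x.
    - exact: cvg_fst.
    - exact: cvg_fst.
  apply: cantor_space_hausdorff => U V cU c'V.
  have [||[x y] [/= Uy Vy]] := bc (snd @^-1` U) (snd @^-1` V); last by exists y.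
  - exact: cvg_snd.
  - exact: cvg_snd.
have cT : compact [set: B * cantor_space].
  by rewrite -setXTT; apply: compact_setX cB cantor_space_compact.
have fstc : continuous (fst : B * cantor_space -> B) by move=> [b c]; exact: cvg_fst.
have sndc : continuous (snd : B * cantor_space -> cantor_space) by move=> [b c]; exact: cvg_snd.
have clK : closed K.
  have -> : K = \bigcap_n (~` [set t : B * cantor_space | t.2 n = true] `|` fst @^-1` s n).
    apply/seteqP; split=> t Kt n; last first.
      by case: (Kt n I).
    by move=> _; have [/Kt|] := boolP (t.2 n); [right|left; apply/negP].
  apply: closed_bigI => n _; apply: closedU.
    apply: open_closedC; exact: (open_cantor_coord sndc).
  by apply: preimage_closed => // t _; exact: fstc.
pose P := K `&` snd @^-1` M.
have /choice[f fP] : forall t : P, exists x, e x = (set_val t).1.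
  move=> t; have [Kt Mt] := set_mem (valP t).
  by have [|x _ xt] := AE (set_val t).1; [exact: Mt|exists x].
exists P, f; split.
- exact: p_space_cantor_preimage.
- exact: lindelof_cantor_preimage.
- move=> t U /(compactification_nbhs ce)[V tV VU]; apply/nbhs_set_val.
  exists (fst @^-1` V); first by apply: fstc; rewrite -fP.
  by move=> y Vy; apply: VU; rewrite /preimage /= fP.
- apply/seteqP; split=> [_ [t _ <-]|x Ax].
    by rewrite /preimage /= fP; have [Kt Mt] := set_mem (valP t); exact: Mt.
  (* [c] records every [s n] containing [e x]; separation says that these sets intersect inside
     [A]. *)
  pose c : cantor_space := fun n => `[< s n (e x) >].
  have Pxc : P (e x, c).
    split=> [n /asboolP//|b sb]; apply: contrapT => nAb.
    have [C [/sF[n _ <-] nx nb]] := sepF _ _ Ax nAb.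
    by apply: nb; apply: sb; apply/asboolP.
  exists (exist (fun t => t \in P) (e x, c) (mem_set Pxc)) => //.
  by apply: (compactification_inj ce); rewrite fP.
Qed.

Unset Implicit Arguments.

Theorem theorem5p5 (X : topologicalType) :
  tychonoff_space X -> regular_space X -> locally_menger X -> p_space X ->
  has_homogeneous_remainder X ->
  exists L Z : set X,
    [/\ [set: X] = L `|` Z, closed L, lindelof_sigma_subspace L,
        open Z & locally_compact_subspace Z].
Proof.
move=> _ _ lmX pX [B [e [ce homR]]]; have [hB cB _ _ _] := ce.
have ec := compactification_continuous ce.
set R := ~` range e in homR.
have RC b : ~ R b -> range e b by move=> /contrapT.
have near_e x : separated_near R (e x).
  have [G [V [xG clG ctV oV sepV]]] := locally_menger_separation x ce pX lmX.
  exists G, [set closure P | P in V]; split => //.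
  - by apply: sub_countable ctV; exact: card_image_le.
  - by move=> _ [P _ <-]; exact: closed_closure.
  move=> a r [[Ga _] /RC Ea] [_ Rr].
  have [P [VP Pa nPr]] := sepV a r (conj Ga Ea) Rr.
  by exists (closure P); split => //; [exists P|exact: subset_closure].
have near_R b : closure R b -> separated_near R b.
  move=> Rb; have [Rb'|/RC[x _ <-]//] := pselect (R b).
  (* If no point of [X] is in the closure of [R], there is nothing to separate. Otherwise a
     neighbourhood of such a point meets [R] at some [y], and homogeneity carries the separation
     from [y] to [b]. *)
  have [[x Rx]|nR] := pselect (exists x, closure R (e x)); last first.
    exists setT, set0; split => //; first exact: filterT.
    by move=> a r [[_ Ra] /RC[x _ xa]]; case: nR; exists x; rewrite xa.
  have [G [V [xG clG ctV oV sepV]]] := locally_menger_separation x ce pX lmX.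
  have [y [Ry Gy]] := Rx _ (nbhs_interior xG).
  apply: (@homogeneous_separated_near B R G V y b) => // a r [Ga /RC Ea] Rr.
  exact: sepV.
have [F [ctF clF sepF]] := separated_near_closure hB cB near_R.
exists (e @^-1` closure R), (~` (e @^-1` closure R)).
have clL : closed (e @^-1` closure R).
  by apply: preimage_closed; [move=> x _; exact: ec|exact: closed_closure].
split => //.
- by rewrite setUv.
- have -> : e @^-1` closure R = e @^-1` (closure R `\` R).
    apply/seteqP; split=> [x Rx|x []//]; split => //; apply; by exists x.
  by apply: separated_lindelof_sigma ce _ ctF clF sepF => b [_ /RC].
- exact: closed_openC.
(* A closed neighbourhood of [e z] missing [closure R] lies in the range of [e], so its preimage is
   compact. *)
move=> z nRz; have [|G zG GR] := compact_hausdorff_regular hB cB (_ : nbhs (e z) (~` closure R)).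
  by apply: open_nbhs_nbhs; split => //; apply: closed_openC; exact: closed_closure.
exists (e @^-1` closure G); split.
- apply: (compact_preimage_compactification ce); first exact: closed_closure.
  by move=> b /GR nRb; apply: RC => Rb; apply: nRb; exact: subset_closure.
- by move=> x /GR.
- by apply: ec; apply: filterS zG; exact: subset_closure.
Qed.
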